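(* For $\alpha\in(0,1)$, $\lambda\in(0,1]$ and $n\in\mathbb{N}=\{1,2,3,\dots\}$, let $$R(\alpha,n,\lambda)=\frac{\alpha\lambda^\alpha\sin \alpha\pi}{\pi}\int_0^1 t^{\alpha-1}(1-t)^{\alpha n}\left\{\frac{1}{|t^\alpha-\lambda^\alpha e^{-i\alpha\pi}|^2}+\frac{\lambda^{\alpha n}}{|e^{-i\alpha\pi}-(\lambda t)^\alpha|^2}\right\}dt .$$ Then, for each fixed $\alpha\in(0,1)$ and $\lambda\in(0,1]$, the sequence $R(\alpha,n,\lambda)$ converges monotonically (decreasingly in $n$) to $0$ as $n\to\infty$. *)

(* Defs.v *)
From HB Require Import structures.
From mathcomp Require Import all_boot all_order all_algebra.
From mathcomp Require Import all_classical all_reals all_analysis.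
From mathcomp Require Import complex.

Set Implicit Arguments.
Unset Strict Implicit.
Unset Printing Implicit Defensive.

Import Order.TTheory GRing.Theory Num.Theory.
Import numFieldNormedType.Exports.

Local Open Scope classical_set_scope.
Local Open Scope ring_scope.

Section RemainderIntegral.
Variable R : realType.

Definition expi (theta : R) : R[i] := Complex (cos theta) (sin theta).

(* [`|z|] on [R[i]] is itself [R[i]]-valued; this is the real-valued modulus. *)
Definition cmod (z : R[i]) : R := ComplexField.Normc.normc z.

Definition Rintegrand (alpha : R) (n : nat) (lambda t : R) : R :=
  t `^ (alpha - 1) * (1 - t) `^ (alpha * n%:R) *
  (1 / cmod ((t `^ alpha)%:C%C
             - (lambda `^ alpha)%:C%C * expi (- (alpha * pi))) ^+ 2
   + lambda `^ (alpha * n%:R)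
     / cmod (expi (- (alpha * pi)) - ((lambda * t) `^ alpha)%:C%C) ^+ 2).

(* The endpoints are left out because the integrand is singular at [t = 0],
   where [powR] takes a conventional value; they have measure zero. *)
Definition Rrem (alpha : R) (n : nat) (lambda : R) : R :=
  alpha * lambda `^ alpha * sin (alpha * pi) / pi *
  \int[lebesgue_measure]_(t in `]0, 1[) Rintegrand alpha n lambda t.

End RemainderIntegral.

(* Main.v *)
(** Put [q = (1 - t)^alpha < 1], [l = lambda^alpha <= 1] and [s = sin (alpha pi)].
    The integrand is [t^(alpha - 1) q^n (A + l^n B)], where [A] and [B] do not
    depend on [n] and satisfy [0 < A <= 1 / (l s)^2] and [0 < B <= 1 / s^2],
    since a squared modulus is at least the square of its imaginary part. It
    therefore decreases strictly in [n], tends to [0] pointwise, and is dominated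
    by a multiple of [t^(alpha - 1)], which is integrable on [(0, 1)]. *)

Require Import Defs.
From HB Require Import structures.
From mathcomp Require Import all_boot all_order all_algebra.
From mathcomp Require Import all_classical all_reals all_analysis.
From mathcomp Require Import complex.
From mathcomp Require Import measurable_realfun ring.

Import Order.TTheory GRing.Theory Num.Theory.
Import numFieldNormedType.Exports.

Local Open Scope classical_set_scope.
Local Open Scope ring_scope.

(** * Strict monotonicity of the integral *)

Lemma lt_Rintegral (d : measure_display) (T : measurableType d) (R : realType)
    (mu : {measure set T -> \bar R}) (D : set T) (f g : T -> R) :
  measurable D -> mu D != 0%E ->
  mu.-integrable D (EFin \o f) -> mu.-integrable D (EFin \o g) ->
  (forall x, D x -> f x < g x) ->
  \int[mu]_(x in D) f x < \int[mu]_(x in D) g x.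
Proof.
move=> mD muD0 intf intg ltfg.
have intB : mu.-integrable D (EFin \o (g \- f)).
  rewrite [EFin \o _](_ : _ = (EFin \o g) \- (EFin \o f))%E.
    exact: integrableB.
  by apply/funext => x /=; rewrite EFinB.
rewrite -subr_gt0 -RintegralB// lt_neqAle Rintegral_ge0; last first.
  by move=> x Dx; rewrite subr_ge0 ltW// ltfg.
(* If the nonnegative [g - f] had integral 0, it would vanish almost everywhere on [D]; as it is
   positive throughout [D], this puts [D] inside a null set. *)
rewrite andbT eq_sym; apply: contra muD0 => /eqP int0.
have abs0 : (\int[mu]_(x in D) `|(EFin \o (g \- f)%R) x| = 0)%E.
  rewrite (eq_integral (EFin \o (g \- f))); last first.
    move=> x /[!inE] Dx /=.
    by rewrite ger0_norm// subr_ge0 ltW// ltfg.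
  rewrite -[LHS]fineK; last exact: integrable_fin_num.
  by congr EFin.
have [N [mN muN0 DN]] :=
  (ae_eq_integral_abs mu mD (measurable_int mu intB)).1 abs0.
rewrite -measure_le0 -muN0; apply: le_measure; rewrite ?inE//.
move=> x Dx; apply: DN => /= /(_ Dx) [] /eqP.
by rewrite subr_eq0 gt_eqF// ltfg.
Qed.

(** * Integrability of powers near 0 *)

Lemma integral_powR_itvcc (R : realType) (a e : R) : a != 0 -> 0 < e < 1 ->
  (\int[lebesgue_measure]_(t in `[e, 1%R]) (t `^ (a - 1))%:E =
   ((1 - e `^ a) / a)%:E)%E.
Proof.
move=> a0 /andP[e0 e1].
have dF b : {in `[e, 1], forall x : R, derivable (@powR R ^~ b) x 1}.
  move=> x /[!in_itv]/= /andP[ex _]; apply: derivable_powR.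
  by rewrite in_itv/= andbT (lt_le_trans e0).
have cF b : {within `[e, 1], continuous (@powR R ^~ b)}.
  exact: derivable_within_continuous.
(* The antiderivative is [t^a / a]; since [0 < e], the interval avoids the singularity at 0. *)
rewrite (@continuous_FTC2 _ _ (fun t => t `^ a / a)) //.
- by rewrite -EFinB powR1 -mulrBl.
- have /(continuous_within_itvP _ e1) [_ cl cr] := cF a.
  split=> [x /subset_itv_oo_cc xe||]; last 2 first.
  + by apply: cvgMl.
  + by apply: cvgMl.
  by apply: derivableM => //; exact: dF.
- move=> x xe.
  have x0 : 0 < x by move: xe; rewrite in_itv/= => /andP[/(lt_trans e0)].
  rewrite derive1E deriveMr; last exact/dF/subset_itv_oo_cc.
  rewrite -derive1E powR_derive1 ?in_itv/= ?x0//.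
  rewrite /GRing.scale/= mulrA mulVf// mul1r//.
Qed.

(** Monotone convergence along closed intervals shrinking towards 0 on the left: their integrals
    [(1 - e^a) / a] all stay below [1 / a]. *)
Lemma integrable_powR (R : realType) (a : R) : 0 < a ->
  (@lebesgue_measure R).-integrable `]0, 1[
    (EFin \o (fun t => t `^ (a - 1))).
Proof.
move=> a0.
have mf (D : set R) : measurable_fun D (EFin \o (fun t : R => t `^ (a - 1))).
  by apply/measurable_EFinP/measurable_funTS; exact: measurable_powR.
apply/integrableP; split; first exact: mf.
under eq_integral do rewrite /= ger0_norm ?powR_ge0//.
(* Starting at [1 / (n + 2)] keeps the left endpoint strictly below 1, as the closed formula
   requires. The union covers []0, 1[]. *)
pose F (n : nat) : set R := `[n.+2%:R^-1, 1]%classic.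
apply: (@le_lt_trans _ _ (\int[lebesgue_measure]_(x in \bigcup_i F i) (x `^ (a - 1))%:E)%E).
  apply: ge0_subset_integral => //.
  - by apply: bigcup_measurable => n _; exact: measurable_itv.
  - exact: mf.
  - by move=> x _; rewrite lee_fin powR_ge0.
  move=> x /=; rewrite in_itv/= => /andP[x0 x1].
  have [n _ /(_ n (leqnn n)) nx] := near_infty_natSinv_lt (PosNum x0).
  exists n => //; rewrite /F/= in_itv/= (ltW x1) andbT.
  apply: le_trans (ltW nx) => /=.
  by rewrite lef_pV2 ?posrE// ler_nat.
apply: (@le_lt_trans _ _ (a^-1)%:E); last exact: ltry.
have cF : (\int[lebesgue_measure]_(x in F n) (x `^ (a - 1))%:E)%E @[n --> \oo] -->
    (\int[lebesgue_measure]_(x in \bigcup_i F i) (x `^ (a - 1))%:E)%E.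
  apply: (@ge0_nondecreasing_set_cvg_integral _ (measurableTypeR R) R F
    (EFin \o (fun t => t `^ (a - 1))) lebesgue_measure) => //.
  - move=> n m nm; rewrite subsetEset; apply: subset_itvr.
    by rewrite bnd_simp lef_pV2 ?posrE// ler_nat.
  - by move=> i; exact: measurable_itv.
  - by move=> i; exact: mf.
  - by move=> i x _; rewrite lee_fin powR_ge0.
rewrite -(cvg_lim _ cF)//; apply: lime_le.
  by apply/cvg_ex; eexists; exact: cF.
apply: nearW => n; rewrite integral_powR_itvcc ?gt_eqF//; last first.
  by rewrite invr_gt0 ltr0n/= invf_lt1// ltr1n.
by rewrite lee_fin ler_piMl ?invr_ge0 ?(ltW a0)// lerBlDr lerDl powR_ge0.
Qed.

Lemma cmod_sqr (R : realType) (x y : R) :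
  cmod (Complex x y) ^+ 2 = x ^+ 2 + y ^+ 2.
Proof. by rewrite /cmod /= sqr_sqrtr// addr_ge0 ?sqr_ge0. Qed.

(** * Bounds and limits for the integrand *)

Section Integrand.
Variables (R : realType) (alpha lambda : R).
Hypotheses (alpha_gt0 : 0 < alpha) (alpha_lt1 : alpha < 1).
Hypotheses (lambda_gt0 : 0 < lambda) (lambda_le1 : lambda <= 1).

Let c := cos (alpha * pi).
Let s := sin (alpha * pi).
Let l := lambda `^ alpha.
(** [den1] and [den2] are the two squared moduli, written as sums of squares of real and imaginary
    parts. *)
Let den1 (t : R) := (t `^ alpha - l * c) ^+ 2 + (l * s) ^+ 2.
Let den2 (t : R) := (c - (lambda * t) `^ alpha) ^+ 2 + s ^+ 2.

Let sin_alpha_gt0 : 0 < s.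
Proof. by rewrite sin_gt0_pi// mulr_gt0 ?pi_gt0//= gtr_pMl ?pi_gt0. Qed.

Let l_gt0 : 0 < l. Proof. exact: powR_gt0. Qed.

Let l_le1 : l <= 1.
Proof.
rewrite -[leRHS](_ : 1 `^ alpha = _); last by rewrite powR1.
by rewrite ge0_ler_powR ?nnegrE// ltW.
Qed.

(** Real exponents [alpha * n] become natural powers of [(1 - t)^alpha] and of [l], so the
    dependence on [n] is geometric. *)
Let RintegrandE n t : Rintegrand alpha n lambda t =
  t `^ (alpha - 1) * ((1 - t) `^ alpha) ^+ n *
  ((den1 t)^-1 + l ^+ n * (den2 t)^-1).
Proof.
rewrite /Rintegrand /expi !powRrM !powR_mulrn ?powR_ge0//.
rewrite cosN sinN -/c -/s -/l div1r; congr (_ * (_^-1 + _ / _)).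
- by rewrite [X in cmod X](_ : _ = Complex (t `^ alpha - l * c) (l * s));
    [rewrite cmod_sqr|simpc].
- by rewrite [X in cmod X](_ : _ = Complex (c - (lambda * t) `^ alpha) (- s));
    [rewrite cmod_sqr sqrrN|simpc].
Qed.

Let den1_ge t : (l * s) ^+ 2 <= den1 t.
Proof. by rewrite lerDr sqr_ge0. Qed.

Let den2_ge t : s ^+ 2 <= den2 t.
Proof. by rewrite lerDr sqr_ge0. Qed.

Let den1_gt0 t : 0 < den1 t.
Proof. by apply: lt_le_trans (den1_ge t); rewrite exprn_gt0 ?mulr_gt0. Qed.

Let den2_gt0 t : 0 < den2 t.
Proof. by apply: lt_le_trans (den2_ge t); rewrite exprn_gt0. Qed.

Let measurable_Rintegrand n D :
  measurable_fun D (Rintegrand alpha n lambda : R -> R).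
Proof.
apply: measurable_funTS; rewrite (funext (RintegrandE n)).
(* The inverse of a positive function is its power of exponent -1, so measurability of [powR]
   applies. *)
have mV (f : R -> R) : measurable_fun setT f -> (forall t, 0 < f t) ->
    measurable_fun setT (fun t => (f t)^-1).
  move=> mf f0; under eq_fun do rewrite -(powR_inv1 (ltW (f0 _))).
  exact: (measurableT_comp (measurable_powR _)).
have mpow (f : R -> R) p : measurable_fun setT f ->
    measurable_fun setT (fun t => f t `^ p).
  by move=> mf; exact: (measurableT_comp (measurable_powR _)).
apply: measurable_funM.
  apply: measurable_funM; first exact: mpow.
  by apply: measurable_funX; apply: mpow; exact: measurable_funB.
apply: measurable_funD; last apply: measurable_funM => //; apply: mV => //.
- apply: measurable_funD => //; apply: measurable_funX.
  by apply: measurable_funB => //; exact: mpow.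
- apply: measurable_funD => //; apply: measurable_funX.
  by apply: measurable_funB => //; apply: mpow; exact: measurable_funM.
Qed.

Let K := ((l * s) ^+ 2)^-1 + (s ^+ 2)^-1.

Let factor_ge0 n t : 0 <= (den1 t)^-1 + l ^+ n * (den2 t)^-1.
Proof.
by rewrite addr_ge0 ?mulr_ge0 ?exprn_ge0 ?invr_ge0 ?(ltW (den1_gt0 _))
  ?(ltW (den2_gt0 _)) ?(ltW l_gt0).
Qed.

Lemma Rintegrand_ge0 n t : 0 <= Rintegrand alpha n lambda t.
Proof. by rewrite RintegrandE !mulr_ge0 ?exprn_ge0 ?powR_ge0. Qed.

(** The geometric factor is kept here because it drives the pointwise limit; the bound without it
    serves as the dominating function. *)
Let Rintegrand_le_geom n t :
  Rintegrand alpha n lambda t <=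
  K * t `^ (alpha - 1) * ((1 - t) `^ alpha) ^+ n.
Proof.
rewrite RintegrandE [leRHS](_ : _ =
  t `^ (alpha - 1) * ((1 - t) `^ alpha) ^+ n * K); last by ring.
rewrite ler_wpM2l ?mulr_ge0 ?exprn_ge0 ?powR_ge0//.
apply: lerD; first by rewrite lef_pV2 ?posrE ?exprn_gt0 ?mulr_gt0.
apply: (@le_trans _ _ (den2 t)^-1).
  rewrite ler_piMl ?invr_ge0 ?(ltW (den2_gt0 _))//.
  by rewrite exprn_ile1// ltW.
by rewrite lef_pV2 ?posrE ?exprn_gt0.
Qed.

Let K_ge0 : 0 <= K.
Proof. by rewrite addr_ge0 ?invr_ge0 ?exprn_ge0// ?mulr_ge0// ltW. Qed.

Let base_bounds (t : R) : 0 < t < 1 -> 0 < (1 - t) `^ alpha < 1.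
Proof.
move=> /andP[t0 t1]; rewrite powR_gt0 ?subr_gt0//=.
rewrite -[ltRHS](_ : 1 `^ alpha = _); last by rewrite powR1.
by rewrite gt0_ltr_powR ?nnegrE// ?subr_ge0 ?ltW//;
  rewrite ltrBlDr ltrDl.
Qed.

Let Rintegrand_le n t : 0 < t < 1 ->
  Rintegrand alpha n lambda t <= K * t `^ (alpha - 1).
Proof.
move=> /base_bounds/andP[q0 q1].
apply: le_trans (Rintegrand_le_geom _ _) _.
by rewrite ler_piMr ?mulr_ge0 ?powR_ge0// exprn_ile1// ltW.
Qed.

Let integrable_majorant : (@lebesgue_measure R).-integrable `]0, 1[
  (fun t => (K * t `^ (alpha - 1))%:E).
Proof.
rewrite (_ : (fun t => _) = fun t => (K%:E * (t `^ (alpha - 1))%:E)%E).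
  by apply: integrableZl => //; exact: integrable_powR.
by apply/funext => t; rewrite EFinM.
Qed.

Let abs_Rintegrand_le n (t : R) : `]0, 1[%classic t ->
  (`|(Rintegrand alpha n lambda t)%:E| <= (K * t `^ (alpha - 1))%:E)%E.
Proof.
move=> /=; rewrite in_itv/= => t01.
by rewrite lee_fin ger0_norm ?Rintegrand_ge0// Rintegrand_le.
Qed.

Lemma integrable_Rintegrand n :
  (@lebesgue_measure R).-integrable `]0, 1[ (EFin \o Rintegrand alpha n lambda).
Proof.
apply: (le_integrable _ _ _ integrable_majorant) => //.
  apply/measurable_EFinP; exact: measurable_Rintegrand.
move=> t t01; apply: le_trans (abs_Rintegrand_le n t t01) _.
by rewrite lee_fin ler_norm.
Qed.

Lemma Rintegrand_decr n t : 0 < t < 1 ->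
  Rintegrand alpha n.+1 lambda t < Rintegrand alpha n lambda t.
Proof.
move=> t01; have /andP[q0 q1] := base_bounds _ t01; case/andP: t01 => t0 t1.
rewrite !RintegrandE -!mulrA ltr_pM2l ?powR_gt0//.
rewrite exprSr -mulrA ltr_pM2l ?exprn_gt0//.
(* After cancelling [t^(alpha - 1)] and the [n]-th power, lowering [l^(n+1)] to [l^n] gives only a
   weak inequality, since [l] may be 1. Strictness comes from [(1 - t)^alpha < 1] and the positivity
   of [(den1 t)^-1]. *)
apply: (@le_lt_trans _ _ ((1 - t) `^ alpha *
    ((den1 t)^-1 + l ^+ n * (den2 t)^-1))); last first.
  rewrite gtr_pMl// ltr_wpDr ?invr_gt0 ?den1_gt0// mulr_ge0//.
    by rewrite exprn_ge0// ltW.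
  by rewrite invr_ge0 ltW.
rewrite ler_wpM2l ?powR_ge0// lerD2l ler_wpM2r ?invr_ge0 ?(ltW (den2_gt0 _))//.
by rewrite exprS ler_piMl// exprn_ge0// ltW.
Qed.

Lemma Rintegrand_cvg0 (t : R) : 0 < t < 1 ->
  Rintegrand alpha n lambda t @[n --> \oo] --> 0.
Proof.
move=> t01; have /andP[q0 q1] := base_bounds _ t01.
apply: (@squeeze_cvgr _ _ _ _ (cst 0)
  (fun n => K * t `^ (alpha - 1) * ((1 - t) `^ alpha) ^+ n)).
- by apply: nearW => n; rewrite Rintegrand_ge0 Rintegrand_le_geom.
- exact: cvg_cst.
- rewrite -[X in _ --> X](mulr0 (K * t `^ (alpha - 1))).
  by apply: cvgMr; apply: cvg_expr; rewrite ger0_norm// ltW.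
Qed.

Lemma Rintegral_Rintegrand_cvg0 :
  \int[lebesgue_measure]_(t in `]0, 1[) Rintegrand alpha n lambda t
    @[n --> \oo] --> (0 : R).
Proof.
(* Dominated convergence is applied to extended real integrals, and [fine_cvgP] carries the limit
   back to the reals. *)
have /fine_cvgP[_] : (\int[@lebesgue_measure R]_(t in `]0%R, 1%R[)
    (Rintegrand alpha n lambda t)%:E)%E @[n --> \oo] --> 0%:E.
  rewrite -[X in _ --> X](integral0 (@lebesgue_measure R) `]0, 1[%classic).
  apply: (dominated_cvg _ _ _ _ integrable_majorant) => //.
  - by move=> n; apply/measurable_EFinP; exact: measurable_Rintegrand.
  - move=> t /=; rewrite in_itv/= => t01.
    by apply: cvg_EFin; [exact: nearW|exact: Rintegrand_cvg0].
by [].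
Qed.

(** The sine is positive because [alpha * pi] lies in []0, pi[]. Positivity lets a strict inequality
    of integrals pass to [Rrem]. *)
Lemma Rrem_const_gt0 : 0 < alpha * lambda `^ alpha * sin (alpha * pi) / pi.
Proof. by rewrite divr_gt0 ?pi_gt0// !mulr_gt0. Qed.

End Integrand.

Theorem mainTheorem3 (R : realType) (alpha lambda : R)
    (alpha_gt0 : 0 < alpha) (alpha_lt1 : alpha < 1)
    (lambda_gt0 : 0 < lambda) (lambda_le1 : lambda <= 1) :
  (* the integral defining R(alpha, n, lambda) exists for every n >= 1, *)
  (forall n : nat, (1 <= n)%N ->
     (@lebesgue_measure R).-integrable `]0, 1[
       (EFin \o Rintegrand alpha n lambda))
  (* the sequence is decreasing over n = 1, 2, 3, ... *)
  /\ (forall n : nat, (1 <= n)%N ->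
        Rrem alpha n.+1 lambda < Rrem alpha n lambda)
  (* and it tends to 0 *)
  /\ (Rrem alpha n lambda @[n --> \oo] --> (0 : R)).
Proof.
have C_gt0 := Rrem_const_gt0 R alpha lambda alpha_gt0 alpha_lt1 lambda_gt0.
split; [|split].
- by move=> n _; exact: integrable_Rintegrand.
- move=> n _; rewrite /Rrem ltr_pM2l//; apply: lt_Rintegral => //.
  + have mu01 : lebesgue_measure (`]0, 1[%classic : set R) = 1%E.
      by rewrite lebesgue_measure_itv/= lte_fin ltr01 sube0.
    by rewrite [X in X != _]mu01 onee_eq0.
  + exact: integrable_Rintegrand.
  + exact: integrable_Rintegrand.
  + by move=> t /=; rewrite in_itv/= => t01; exact: Rintegrand_decr.
- rewrite /Rrem -[X in _ --> X](mulr0 (alpha * lambda `^ alpha *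
    sin (alpha * pi) / pi)).
  by apply: cvgMr; exact: Rintegral_Rintegrand_cvg0.
Qed.
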